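(* Let $\mathcal{G}$ be a switched affine system model and $\bar{\mathcal{G}}_1,\dots,\bar{\mathcal{G}}_{N_f}$ ($N_f\ge2$) fault models such that for each $j$ the pair $(\mathcal{G},\bar{\mathcal{G}}_j)$ is $T_j$-distinguishable for a finite $T_j$, and for all $m\ne n$ the pair $(\bar{\mathcal{G}}_m,\bar{\mathcal{G}}_n)$ is $I_{m,n}$-distinguishable for a finite $I_{m,n}$ (with $I_{m,n}=I_{n,m}$). Let $\tilde I_i=\max_{j\ne i}I_{i,j}$. Then, for every $i\in\{1,\dots,N_f\}$, under the fault detection and isolation (FDI) scheme described in the context, the detection delay for fault $\bar{\mathcal{G}}_i$ is at most $T_i$, and the isolation delay for fault $\bar{\mathcal{G}}_i$ is at most $K_i=\max\{\tilde I_i,T_i\}$.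
   Context: SWA model: $\mathcal{G}=(\mathcal{X},\mathcal{E},\mathcal{U},\{G_i\}_{i=1}^m)$, where $\mathcal{X}\subset\mathbb{R}^n$ (states), $\mathcal{E}\subset\mathbb{R}^{n_y+n}$ (measurement noise $\boldsymbol{\eta}\in\mathbb{R}^{n_y}$ stacked with process noise $\boldsymbol{\nu}\in\mathbb{R}^{n}$) and $\mathcal{U}\subset\mathbb{R}^{n_u}$ (inputs) are convex and compact, of the form $\mathcal{X}=\{\mathbf{x}: P\mathbf{x}\le p\}$, $\mathcal{E}=\{\|\boldsymbol{\eta}\|\le\epsilon_\eta,\|\boldsymbol{\nu}\|\le\epsilon_\nu\}$, $\mathcal{U}=\{\|\mathbf{u}\|\le U\}$ (infinity norms), and each mode $G_i=\{\mathbf{A}_i,\mathbf{B}_i,\mathbf{C}_i,\mathbf{D}_i,\mathbf{f}_i,\mathbf{g}_i\}$ consists of real matrices and vectors of compatible dimensions. The evolution is $$\mathbf{x}_{t+1}=\mathbf{A}_{\sigma_t}\mathbf{x}_t+\mathbf{B}_{\sigma_t}\mathbf{u}_t+\mathbf{f}_{\sigma_t}+\boldsymbol{\nu}_t,\qquad \mathbf{y}_t=\mathbf{C}_{\sigma_t}\mathbf{x}_t+\mathbf{D}_{\sigma_t}\mathbf{u}_t+\mathbf{g}_{\sigma_t}+\boldsymbol{\eta}_t,$$ with active mode $\sigma_t\in\{1,\dots,m\}$. A fault model for $\mathcal{G}$ is another SWA model with the same numbers of states, inputs and outputs. Length-$N$ behavior: $\mathcal{B}^N_{swa}(\mathcal{G})$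 is the set of all sequences $\{\mathbf{u}_t,\mathbf{y}_t\}_{t=0}^{N-1}$ with $\mathbf{u}_t\in\mathcal{U}$ for which there exist $\mathbf{x}_t\in\mathcal{X}$, $\sigma_t\in\{1,\dots,m\}$, $[\boldsymbol{\eta}_t^\intercal\ \boldsymbol{\nu}_t^\intercal]^\intercal\in\mathcal{E}$ for $t=0,\dots,N-1$ such that the evolution equations hold for $t=0,\dots,N-1$ (the state $\mathbf{x}_N$ is any vector of $\mathbb{R}^n$, not required to lie in $\mathcal{X}$). Membership of a window $\{\mathbf{u}_k,\mathbf{y}_k\}_{k=a}^{a+N-1}$ in $\mathcal{B}^N_{swa}$ is understood after shifting its time index to start at $0$. $T$-distinguishability: two SWA models are $T$-distinguishable if their length-$T$ behaviors are disjoint. Data: an input-output signal $\{\mathbf{u}_t,\mathbf{y}_t\}$ is observed (with enough past samples available to fill the windows used below). Fault $i$ occurs at time $t^*$ and is persistent: every window of the signal of length $L$ contained in times $\ge t^*$ lies in $\mathcal{B}^L_{swa}(\bar{\mathcal{G}}_i)$, and every window of length $L$ contained in times $<t^*$ lies in $\mathcal{B}^L_{swa}(\mathcal{G})$. FDI scheme: put $T=\max_j T_j$ and $K_j=\max\{\tilde I_j,T_j\}$ for each $j$. At each time $t$, monitor $\mathcal{M}_0$ checks (by model invalidation) whether the window $\{\mathbf{u}_k,\mathbf{y}_k\}_{k=t-T+1}^{t}$ lies in $\mathcal{B}^T_{swa}(\mathcal{G})$; a fault is declared (detected) at time $t$ if and only if it does not. When a fault is declared by $\mathcal{M}_0$,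 each monitor $\mathcal{M}_j$, $j=1,\dots,N_f$, checks whether the window $\{\mathbf{u}_k,\mathbf{y}_k\}_{k=t-K_j+1}^{t}$ lies in $\mathcal{B}^{K_j}_{swa}(\bar{\mathcal{G}}_j)$. Fault $i$ is isolated at time $t$ if a fault is declared at time $t$, the check of $\mathcal{M}_i$ succeeds, and the check of $\mathcal{M}_j$ fails for every $j\in\{1,\dots,N_f\}$, $j\ne i$. Delays: the detection (respectively isolation) delay is the number of time samples from the occurrence of the fault to its detection (respectively isolation); that is, if the first time $t\ge t^*$ of detection (isolation) is $t'$, the delay is $t'-t^*+1$. *)

(* Defs.v *)
From mathcomp Require Import all_boot all_order all_algebra.
From mathcomp Require Import all_classical all_reals all_analysis.

Set Implicit Arguments.
Unset Strict Implicit.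
Unset Printing Implicit Defensive.

Import Order.TTheory GRing.Theory Num.Theory.
Import numFieldNormedType.Exports.

Local Open Scope classical_set_scope.
Local Open Scope ring_scope.

Section SwitchedAffine.
Variables (R : realType) (n nu ny : nat).

Record mode := Mode {
  matA : 'M[R]_n;
  matB : 'M[R]_(n, nu);
  matC : 'M[R]_(ny, n);
  matD : 'M[R]_(ny, nu);
  vecf : 'cV[R]_n;
  vecg : 'cV[R]_ny }.

Definition polyhedron (q : nat) (P : 'M[R]_(q, n)) (p : 'cV[R]_q) :
    set 'cV[R]_n :=
  [set x | forall k, (P *m x) k 0 <= p k 0].

(* The norm [`|_|] on matrices is the entrywise maximum, so on column vectors
   it is the infinity norm.  The noise and input sets below are then convex and
   compact for any bounds; a polyhedron is convex but possibly unbounded, hence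
   the field [state_compact]. *)
Record swa := SWA {
  nmodes : nat;
  nfacets : nat;
  state_mx : 'M[R]_(nfacets, n);
  state_bound : 'cV[R]_nfacets;
  state_compact : compact (polyhedron state_mx state_bound);
  eps_eta : R;
  eps_nu : R;
  input_bound : R;
  modes : 'I_nmodes -> mode }.

Definition state_set (G : swa) : set 'cV[R]_n :=
  polyhedron (state_mx G) (state_bound G).

Definition noise_set (G : swa) : set 'cV[R]_(ny + n) :=
  [set e | `|usubmx e| <= eps_eta G /\ `|dsubmx e| <= eps_nu G].

Definition input_set (G : swa) : set 'cV[R]_nu :=
  [set u | `|u| <= input_bound G].

Definition sample : Type := ('cV[R]_nu * 'cV[R]_ny)%type.

(* The state trajectory is given as a function on [nat], of which only
   [x 0], ..., [x N] matter; [x N] is not required to lie in [state_set G]. *)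
Definition behavior (N : nat) (G : swa) : set ('I_N -> sample) :=
  [set w | (forall t, input_set G (w t).1) /\
    exists (x : nat -> 'cV[R]_n) (sigma : 'I_N -> 'I_(nmodes G))
           (eta : 'I_N -> 'cV[R]_ny) (nu' : 'I_N -> 'cV[R]_n),
    forall t : 'I_N,
      [/\ state_set G (x t),
          noise_set G (col_mx (eta t) (nu' t)),
          x t.+1 = matA (modes (sigma t)) *m x t
                   + matB (modes (sigma t)) *m (w t).1
                   + vecf (modes (sigma t)) + nu' t
        & (w t).2 = matC (modes (sigma t)) *m x t
                    + matD (modes (sigma t)) *m (w t).1
                    + vecg (modes (sigma t)) + eta t]].

Arguments behavior : clear implicits.

Definition distinguishable (T : nat) (G1 G2 : swa) : Prop :=
  behavior T G1 `&` behavior T G2 = set0.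

(* A signal is observed from time 0 on. *)
Definition signal : Type := nat -> sample.

Definition window (s : signal) (a L : nat) : 'I_L -> sample :=
  fun k => s (a + k)%N.

Arguments window : clear implicits.

(* The window of length [L] ending at time [t], starting at time [t - L + 1];
   meaningful when [L <= t + 1], as the subtraction is truncated. *)
Definition last_window (s : signal) (t L : nat) : 'I_L -> sample :=
  window s (t.+1 - L)%N L.

Arguments last_window : clear implicits.

Definition persistent_fault (G F : swa) (s : signal) (tstar : nat) : Prop :=
  (forall a L, (tstar <= a)%N -> behavior L F (window s a L)) /\
  (forall a L, (a + L <= tstar)%N -> behavior L G (window s a L)).

Section Scheme.
Variables (Nf : nat) (G : swa) (F : 'I_Nf -> swa).
Variables (T : 'I_Nf -> nat) (I : 'I_Nf -> 'I_Nf -> nat).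

Definition Tmax : nat := \max_j T j.

Definition Itilde (i : 'I_Nf) : nat := \max_(j | j != i) I i j.

Definition Kmon (i : 'I_Nf) : nat := maxn (Itilde i) (T i).

Definition fault_detected (s : signal) (t : nat) : Prop :=
  ~ behavior Tmax G (last_window s t Tmax).

Definition fault_isolated (i : 'I_Nf) (s : signal) (t : nat) : Prop :=
  [/\ fault_detected s t,
      behavior (Kmon i) (F i) (last_window s t (Kmon i))
    & forall j, j != i -> ~ behavior (Kmon j) (F j) (last_window s t (Kmon j))].

End Scheme.

(* [d] is the delay of the event [ev] after [tstar]; no [d] qualifies if [ev]
   never occurs from [tstar] on. *)
Definition is_delay (ev : nat -> Prop) (tstar d : nat) : Prop :=
  exists t', [/\ (tstar <= t')%N, ev t',
    forall t, (tstar <= t < t')%N -> ~ ev t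
    & d = (t' - tstar + 1)%N].

End SwitchedAffine.

(* Main.v *)
(* Behaviors are closed under taking subwindows, so a window lying in the
   behaviors of two models is impossible as soon as the two windows overlap in
   enough samples to distinguish the models.  At time [tstar + D - 1] the last
   [D] samples are all faulty.  For [D = T i] the monitor of the healthy model
   overlaps them in [T i] samples; for [D = Kmon T I i] the monitor of each [F j],
   [j != i], overlaps them in at least [I i j] samples. *)
Require Import Defs.
From mathcomp Require Import all_boot all_order all_algebra.
From mathcomp Require Import all_classical all_reals all_analysis.
From mathcomp Require Import zify.

Section Behaviors.
Context {R : realType} {n nu ny : nat}.
Implicit Types (G : swa R n nu ny) (s : signal R nu ny).

Lemma behavior_subwindow {G s a L} b M :
  (a <= b)%N -> (b + M <= a + L)%N ->
  behavior G (window s a (L := L)) -> behavior G (window s b (L := M)).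
Proof.
move=> le_ab le_bM [win_in [x [sigma [eta [nu' traj]]]]].
have shift_lt (t : 'I_M) : (b - a + t < L)%N by have := ltn_ord t; lia.
pose shift t := Ordinal (shift_lt t).
have windowE t : window s b t = window s a (shift t).
  by rewrite /window /= addnA subnKC.
split=> [t|]; first by rewrite windowE.
(* The evolution equations do not depend on time, so the given trajectory, read from time [b - a]
   on, explains the subwindow. *)
exists (fun t => x (b - a + t)%N), (sigma \o shift), (eta \o shift),
  (nu' \o shift) => t /=.
by rewrite windowE addnS; exact: traj (shift t).
Qed.

(* The empty window belongs to every behavior. *)
Lemma distinguishable_gt0 {T G1 G2} : distinguishable T G1 G2 -> (0 < T)%N.
Proof.
case: T => // /seteqP[sub0 _].
have empty_in G (w : 'I_0 -> sample R nu ny) : behavior G w.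
  split=> [[]//|].
  by exists (fun=> 0%R), (fun t : 'I_0 => False_rect _ (notF (ltn_ord t))),
    (fun=> 0%R), (fun=> 0%R) => -[].
by case: (sub0 (fun=> (0%R, 0%R))); split; exact: empty_in.
Qed.

Lemma distinguishable_windows {T G1 G2 s} a1 L1 a2 L2 b :
  distinguishable T G1 G2 ->
  (a1 <= b)%N -> (b + T <= a1 + L1)%N -> (a2 <= b)%N -> (b + T <= a2 + L2)%N ->
  behavior G1 (window s a1 (L := L1)) -> ~ behavior G2 (window s a2 (L := L2)).
Proof.
move=> /seteqP[sub0 _] le1 le1' le2 le2' w1 w2.
by apply: (sub0 (window s b (L := T))); split;
  [exact: behavior_subwindow w1 | exact: behavior_subwindow w2].
Qed.

End Behaviors.

(** The first occurrence from [tstar] on is no later than [tstar + D - 1], whose delay is exactly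
    [D]. *)
Lemma is_delay_le (ev : nat -> Prop) tstar D :
  (0 < D)%N -> ev (tstar + D - 1)%N -> exists d, is_delay ev tstar d /\ (d <= D)%N.
Proof.
move=> D_gt0 evD.
have ex_ev : exists t, (tstar <= t)%N && `[< ev t >].
  by exists (tstar + D - 1)%N; apply/andP; split; [lia | exact/asboolP].
case: (ex_minnP ex_ev) => t /andP[le_t /asboolP ev_t] min_t.
exists (t - tstar + 1)%N; split.
  exists t; split=> // t0 /andP[le_t0 lt_t0] ev_t0.
  by have := min_t t0; rewrite le_t0 asboolT // => /(_ isT); lia.
have := min_t (tstar + D - 1)%N.
by rewrite asboolT // andbT => /(_ ltac:(lia)); lia.
Qed.

Theorem theorem2 (R : realType) (n nu ny Nf : nat) (hNf : (2 <= Nf)%N)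
  (G : swa R n nu ny) (F : 'I_Nf -> swa R n nu ny)
  (T : 'I_Nf -> nat) (I : 'I_Nf -> 'I_Nf -> nat)
  (hT : forall j, distinguishable (T j) G (F j))
  (hI : forall i j, i != j -> distinguishable (I i j) (F i) (F j))
  (hIsym : forall i j, i != j -> I i j = I j i)
  (s : signal R nu ny) (tstar : nat)
  (hpastT : (Tmax T <= tstar.+1)%N)
  (hpastK : forall j, (Kmon T I j <= tstar.+1)%N)
  (i : 'I_Nf)
  (hfault : persistent_fault G (F i) s tstar) :
  (exists d, is_delay (fault_detected G T s) tstar d /\ (d <= T i)%N) /\
  (exists d, is_delay (fault_isolated G F T I i s) tstar d /\ (d <= Kmon T I i)%N).
Proof.
have Ti_gt0 := distinguishable_gt0 (hT i).
have [faulty _] := hfault.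
have le_TK : (T i <= Kmon T I i)%N by rewrite /Kmon leq_maxr.
have le_Tmax : (T i <= Tmax T)%N by exact: (leq_bigmax (F := T)).
have le_IK j k : k != j -> (I j k <= Kmon T I j)%N.
  move=> kj; rewrite /Kmon leq_max; apply/orP; left.
  by rewrite /Itilde; exact: (leq_bigmax_cond (F := I j)).
(* Stated for every [D] from [T i] on, since isolation also requires detection at [D = Kmon T I i].
   The common subwindow is the last [T i] samples. *)
have detected D : (T i <= D)%N -> fault_detected G T s (tstar + D - 1).
  move=> le_TD in_G.
  apply: (distinguishable_windows _ _ tstar D (tstar + D - T i) (hT i) _ _ _ _ in_G);
    [lia.. | exact: faulty].
split; apply: is_delay_le; [by [] | exact: detected | lia |].
split; first exact: detected.
  by apply: faulty; lia.
move=> j ji; have ij : i != j by rewrite eq_sym.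
(* By symmetry [I i j] is bounded by both [Kmon T I i] and [Kmon T I j], so the last [I i j] samples
   lie in the faulty window and in that of monitor [j]. *)
have := le_IK _ _ ji; have := le_IK _ _ ij; rewrite -hIsym // => leIj leIi.
have := hpastK j => pastj.
apply: (distinguishable_windows tstar (Kmon T I i) _ _
  (tstar + Kmon T I i - I i j) (hI _ _ ij)); [lia.. | exact: faulty].
Qed.
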